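(* Let $\mathcal{H}$ be a real Hilbert space, let $\mathcal{Y} \subset \mathcal{H}$ be non-empty and open, and let $f: \mathcal{Y} \to \mathcal{H}$ be continuous. The following are equivalent: (a) $f$ is a proximity operator of a function $\varphi:\mathcal{H} \to \mathbb{R} \cup \{+\infty\}$ (that is, of some such $\varphi$); (b) there exists a convex function $\psi$ that is $C^1$ on $\mathcal{Y}$ such that $f(y) = \nabla \psi(y)$ for each $y \in \mathcal{Y}$.
   Context: For $\varphi: \mathcal{H} \to \mathbb{R}\cup\{+\infty\}$ and $y \in \mathcal{H}$, $\mathrm{prox}_\varphi(y) := \arg\min_{x \in \mathcal{H}} \{\tfrac12\|y-x\|^2 + \varphi(x)\}$ is the set of global minimizers (a minimizer is required to have finite objective value, so the set is empty if $\varphi\equiv+\infty$). A function $f:\mathcal{Y}\to\mathcal{H}$ is a proximity operator of $\varphi$ if $f(y) \in \mathrm{prox}_\varphi(y)$ for each $y\in\mathcal{Y}$. Convex functions are functions $\psi:\mathcal{H}\to\mathbb{R}\cup\{+\infty\}$ convex on all of $\mathcal{H}$; ''$C^1$ on $\mathcal{Y}$'' means finite and continuously Fréchet differentiable on the open set $\mathcal{Y}$. *)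

(* Defs.v *)
(* Over MathComp-Analysis.  A real Hilbert space is a complete normed module H
   over R : realType, with an inner product ip : {dot H for idfun} (symmetric,
   positive definite) inducing the norm: ip x x = `|x| ^+ 2.
   A function Y -> H on an open set Y is given by a total function H -> H of
   which only the values on Y are used. *)
From HB Require Import structures.
From mathcomp Require Import all_boot all_order all_algebra.
From mathcomp Require Import sesquilinear.
From mathcomp Require Import all_classical all_reals all_analysis.

Set Implicit Arguments.
Unset Strict Implicit.
Unset Printing Implicit Defensive.

Import Order.TTheory GRing.Theory Num.Theory.
Import numFieldNormedType.Exports.

Local Open Scope classical_set_scope.
Local Open Scope ring_scope.

Section Defs.
Context {R : realType} {H : completeNormedModType R}.
Implicit Types (phi psi : H -> \bar R) (g : H -> R) (Y : set H) (f : H -> H).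

(* phi takes its values in R `|` {+oo} *)
Definition never_ninfty phi := forall x, phi x != -oo%E.

Definition prox_obj phi (y x : H) : \bar R :=
  ((2^-1 * `|y - x| ^+ 2)%R%:E + phi x)%E.

Definition prox phi (y : H) : set H :=
  [set x | prox_obj phi y x \is a fin_num /\
           forall z, (prox_obj phi y x <= prox_obj phi y z)%E].

Definition proximity_operator phi Y f := forall y, Y y -> prox phi y (f y).

(* For the weights t = 0 and t = 1, the convention 0 * +oo = 0 makes the
   inequality trivial. *)
Definition econvex psi := forall (x z : H) (t : R), 0 <= t <= 1 ->
  (psi (t *: x + (1 - t) *: z)%R
     <= t%:E * psi x + (1 - t)%R%:E * psi z)%E.

(* The last clause is continuity on Y of the Frechet derivative
   y |-> 'd _ y for the operator norm.  [fine] only changes infinite values,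
   and psi is finite on Y, which is open in the intended use. *)
Definition C1_on psi Y :=
  [/\ forall y, Y y -> psi y \is a fin_num,
      forall y, Y y -> differentiable (fine \o psi) y &
      forall y, Y y -> forall e : R, 0 < e ->
        \forall z \near within Y (nbhs y), forall h : H,
          `|'d (fine \o psi) z h - 'd (fine \o psi) y h| <= e * `|h| ].

Definition is_gradient (ip : H -> H -> R) g (y v : H) :=
  differentiable g y /\ forall h : H, 'd g y h = ip v h.

End Defs.

(* Main.v *)
(* Both properties say that [f] is a selection of subgradients on [Y]: some
   finite [p] satisfies [p y + ip (f y) (z - y) <= p z] for all [y], [z] in [Y].
   Expanding the square in the prox objective turns (a) into this inequality
   for [p y = ip y (f y) - `|f y| ^+ 2 / 2 - phi (f y)]; conversely the
   conjugate of [p] over [Y], minus half the squared norm, is a suitable [phi].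
   The supremum of the affine minorants of such a [p] is a convex extension of
   it, and the continuity of [f] upgrades subgradients to Frechet gradients. *)
Require Import Defs.
From HB Require Import structures.
From mathcomp Require Import all_boot all_order all_algebra.
From mathcomp Require Import sesquilinear.
From mathcomp Require Import all_classical all_reals all_analysis.
From mathcomp Require Import ring lra.

Set Implicit Arguments.
Unset Strict Implicit.
Unset Printing Implicit Defensive.

Import Order.TTheory GRing.Theory Num.Theory.
Import numFieldNormedType.Exports.

Local Open Scope classical_set_scope.
Local Open Scope ring_scope.

Lemma diff_intro (K : numFieldType) (V W : normedModType K) (g : V -> W)
    (dg : {linear V -> W}) (x : V) :
    continuous dg -> g \o shift x = cst (g x) + dg +o_ 0 id ->
  differentiable g x /\ 'd g x = dg :> (V -> W).
Proof.
move=> dg_cont dgE; have dE := diff_unique dg_cont dgE.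
by split=> //; apply/diff_locallyP; rewrite dE.
Qed.

Section Subgradients.
Context {R : realType} {H : completeNormedModType R}.
Variables (ip : {dot H for idfun}).
Hypothesis ip_norm : forall x : H, ip x x = `|x| ^+ 2.
Implicit Types (p : H -> R) (phi psi : H -> \bar R) (Y : set H) (f : H -> H).

Lemma ipC u v : ip u v = ip v u.
Proof. by rewrite hermC expr0 mul1r. Qed.

Lemma ip_subl w : {morph ip^~ w : u v / u - v}.
Proof. by move=> u v; rewrite linearBl. Qed.

Lemma ip_addr w : {morph ip w : u v / u + v}.
Proof. by move=> u v; rewrite linearDr. Qed.

Lemma ip_subr w : {morph ip w : u v / u - v}.
Proof. by move=> u v; rewrite linearBr. Qed.

Lemma ip_scaler w a v : ip w (a *: v) = a * ip w v.
Proof. by rewrite linearZr_LR. Qed.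

Lemma ip_scalel w a v : ip (a *: v) w = a * ip v w.
Proof. by rewrite linearZl_LR. Qed.

Lemma sqr_normB u v : `|u - v| ^+ 2 = `|u| ^+ 2 - 2 * ip u v + `|v| ^+ 2.
Proof.
rewrite -!ip_norm ip_subl !ip_subr (ipC v u); ring.
Qed.

(** Cauchy-Schwarz: expand the squared norm of |v| u - |u| v and cancel the positive factor |u|
    |v|. *)
Lemma ip_le u v : ip u v <= `|u| * `|v|.
Proof.
have [->|u0] := eqVneq u 0; first by rewrite linear0l normr0 mul0r.
have [->|v0] := eqVneq v 0; first by rewrite linear0r normr0 mulr0.
have uv_gt0 : 0 < `|u| * `|v| by rewrite mulr_gt0 ?normr_gt0.
have := sqr_ge0 `| `|v| *: u - `|u| *: v|.
rewrite sqr_normB ip_scaler ip_scalel !normrZ !normr_id => le0.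
rewrite -(ler_pM2l uv_gt0); lra.
Qed.

Lemma ip_norm_le u v : `|ip u v| <= `|u| * `|v|.
Proof. by rewrite ler_norml ip_le lerNl -linearNl -(normrN u) ip_le. Qed.

Lemma ip_continuous u : continuous (ip u).
Proof.
apply/linear_bounded_continuous/bounded_funP => r; exists (`|u| * r) => x xr.
by apply: le_trans (ip_norm_le u x) _; rewrite ler_wpM2l.
Qed.

Definition subgradient_on Y f p :=
  forall y z, Y y -> Y z -> p y + ip (f y) (z - y) <= p z.

(* Two subgradient inequalities squeeze the increment of [p]:
   [ip (f y) h <= p (h + y) - p y <= ip (f (h + y)) h]. *)
Lemma subgradient_gradient Y f p : open Y -> {in Y, continuous f} ->
  subgradient_on Y f p -> forall y, Y y -> is_gradient ip p y (f y).
Proof.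
move=> Y_open f_cont sub_p y Yy.
suff [dp dpE] : differentiable p y /\ 'd p y = ip (f y) :> (H -> R).
  by split=> // h; rewrite dpE.
apply: diff_intro; first exact: ip_continuous.
apply/eqaddoP => e e_gt0.
have : \forall z \near y, Y z /\ `|f y - f z| <= e.
  apply: filterI; first exact: open_nbhs_nbhs.
  by have /cvgrPdist_le := f_cont y (mem_set Yy); apply.
rewrite (near_shift 0) subr0 => nearY; near=> h.
have [/= Yhy f_near] : Y (h + y) /\ `|f y - f (h + y)| <= e by near: h.
have h_bnd : `|f y - f (h + y)| * `|h| <= e * `|h| by rewrite ler_wpM2r.
have := sub_p _ _ Yy Yhy; have := sub_p _ _ Yhy Yy.
rewrite addrK (_ : y - (h + y) = - h) ?linearNr; last first.
  by rewrite opprD addrCA subrr addr0.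
move=> p_le p_ge; apply: le_trans h_bnd.
(* The remainder [p (h + y) - p y - ip (f y) h] lies between [0] and [ip (f (h + y) - f y) h], to
   which Cauchy-Schwarz applies. *)
rewrite distrC; apply: le_trans (ip_norm_le _ _); rewrite ip_subl /=.
rewrite -[(_ + _) h]/(p y + ip (f y) h) ler0_norm ?subr_le0// ler_normr.
by apply/orP; right; lra.
Unshelve. all: by end_near. Qed.

(** By Cauchy-Schwarz the differentials at [z] and [y] are at operator-norm distance at most |f z -
    f y|, so continuity of [f] carries over to them. *)
Lemma subgradient_C1 Y f psi : {in Y, continuous f} ->
  (forall y, Y y -> psi y \is a fin_num) ->
  (forall y, Y y -> is_gradient ip (fine \o psi) y (f y)) -> C1_on psi Y.
Proof.
move=> f_cont psi_fin psi_grad; split=> // [y /psi_grad[]//|].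
move=> y Yy e e_gt0; near=> z => h.
have Yz : Y z by near: z; exact: withinT.
have [_ ->] := psi_grad _ Yy; have [_ ->] := psi_grad _ Yz.
rewrite -ip_subl (le_trans (ip_norm_le _ _))// ler_wpM2r// distrC.
near: z; apply: cvg_within; rewrite near_simpl.
by have /cvgrPdist_le := f_cont y (mem_set Yy); apply.
Unshelve. all: by end_near. Qed.

(** By convexity the difference quotients of [psi] from [y] towards [z], with step [t] in (0, 1),
    are at most [psi z - psi y]; their limit as [t] decreases to 0 is [ip (f y) (z - y)]. *)
Lemma convex_subgradient Y f psi : never_ninfty psi -> econvex psi ->
  (forall y, Y y -> psi y \is a fin_num) ->
  (forall y, Y y -> is_gradient ip (fine \o psi) y (f y)) ->
  subgradient_on Y f (fine \o psi).
Proof.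
move=> psi_ninfty psi_cvx psi_fin psi_grad y z Yy Yz.
have [dpsi grad_y] := psi_grad _ Yy.
rewrite addrC -lerBrDr -grad_y -deriveE//.
have der : derivable (fine \o psi) y (z - y) by exact: diff_derivable.
rewrite /derive cvg_at_rightE//.
apply: limr_le; first by apply/cvg_ex; eexists; exact: cvg_dnbhs_at_right der.
near=> t.
have t_gt0 : 0 < t by near: t; exact: nbhs_right_gt.
have t_lt1 : t < 1 by near: t; exact: nbhs_right_lt.
have t01 : 0 <= t <= 1 by rewrite !ltW.
have := psi_cvx z y t t01.
rewrite -(fineK (psi_fin _ Yy)) -(fineK (psi_fin _ Yz)) /= -!EFinM -EFinD.
have -> : t *: z + (1 - t) *: y = t *: (z - y) + y.
  by rewrite scalerBr scalerBl scale1r addrAC addrA.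
(* The intermediate point may lie outside [Y]; there [+oo] is excluded by the finite convexity
   bound. *)
case: (psi _) (psi_ninfty (t *: (z - y) + y)) => [r _||]//=.
rewrite lee_fin => r_le.
rewrite [_ *: _]mulrC ler_pdivrMr//; nra.
Unshelve. all: by end_near. Qed.

Lemma proximity_subgradient Y f phi : proximity_operator phi Y f ->
  exists p, subgradient_on Y f p.
Proof.
move=> prox_f.
exists (fun y => ip y (f y) - 2^-1 * `|f y| ^+ 2 - fine (phi (f y))).
move=> y z Yy Yz.
have phi_fin x : Y x -> phi (f x) \is a fin_num.
  by move=> /prox_f[]; rewrite /prox_obj fin_numD => /andP[].
(* Minimality of [f z] for the objective at [z] is tested against the competitor [f y]. *)
have [_ /(_ (f y))] := prox_f _ Yz.
rewrite /prox_obj -(fineK (phi_fin _ Yy)) -(fineK (phi_fin _ Yz)).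
rewrite -!EFinD lee_fin.
rewrite !sqr_normB ip_subr !(ipC (f y)); lra.
Qed.

(** The squares of [x] cancel in the objective at [y], leaving [conj x - ip y x] up to a constant;
    by Fenchel-Young this is at least [- p y], with equality at [f y]. *)
Lemma subgradient_proximity Y f p : Y !=set0 -> subgradient_on Y f p ->
  exists phi, never_ninfty phi /\ proximity_operator phi Y f.
Proof.
move=> [y0 Yy0] sub_p.
pose conj x := ereal_sup [set (ip z x - p z)%:E | z in Y].
have conj_ge x z : Y z -> ((ip z x - p z)%:E <= conj x)%E.
  by move=> Yz; apply: ereal_sup_ubound; exists z.
(* The subgradient inequality at [y] says that the supremum defining [conj (f y)] is attained at
   [y]. *)
have conj_f y : Y y -> conj (f y) = (ip y (f y) - p y)%:E.
  move=> Yy; apply/eqP; rewrite eq_le conj_ge// andbT.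
  apply: ge_ereal_sup => _ [z Yz <-]; rewrite lee_fin.
  by have := sub_p _ _ Yy Yz; rewrite ip_subr !(ipC (f y)); lra.
pose phi x := (conj x - (2^-1 * `|x| ^+ 2)%:E)%E.
have objE y x : prox_obj phi y x = ((2^-1 * `|y| ^+ 2 - ip y x)%:E + conj x)%E.
  rewrite /prox_obj /phi addeCA -EFinN -EFinD addeC; congr (_%:E + _)%E.
  by rewrite sqr_normB; lra.
exists phi; split=> [x|y Yy].
  rewrite /phi; have := conj_ge x _ Yy0; case: (conj x) => //.
split=> [|z]; rewrite !objE conj_f// -EFinD//.
rewrite (le_trans _ (leeD (lexx _) (conj_ge z _ Yy)))//.
by rewrite -EFinD lee_fin; lra.
Qed.

(** A supremum of affine functions is convex, and a point of [Y] keeps it above [-oo]. At [z] in [Y]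
    no minorant exceeds [p z], and the one based at [z] attains it. *)
Lemma subgradient_extension Y f p : Y !=set0 -> subgradient_on Y f p ->
  exists psi, [/\ never_ninfty psi, econvex psi &
                  forall y, Y y -> psi y = (p y)%:E].
Proof.
move=> [y0 Yy0] sub_p.
pose psi z := ereal_sup [set (p y + ip (f y) (z - y))%:E | y in Y].
have psi_ge z y : Y y -> ((p y + ip (f y) (z - y))%:E <= psi z)%E.
  by move=> Yy; apply: ereal_sup_ubound; exists y.
exists psi; split.
- by move=> z; have := psi_ge z _ Yy0; case: (psi z).
- move=> x z t /andP[t_ge0 t_le1]; apply: ge_ereal_sup => _ [y Yy <-].
  have t'_ge0 : 0 <= 1 - t by rewrite subr_ge0.
  apply: le_trans (leeD (lee_wpmul2l _ (psi_ge x _ Yy))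
                        (lee_wpmul2l _ (psi_ge z _ Yy))); rewrite ?lee_fin//.
  rewrite !ip_subr ip_addr !ip_scaler; lra.
- move=> z Yz; apply/eqP; rewrite eq_le; apply/andP; split.
    by apply: ge_ereal_sup => _ [y Yy <-]; rewrite lee_fin sub_p.
  by have := psi_ge z _ Yz; rewrite subrr linear0r addr0.
Qed.

End Subgradients.

Theorem corollary1 (R : realType) (H : completeNormedModType R)
    (ip : {dot H for idfun}) (ip_norm : forall x : H, ip x x = `|x| ^+ 2)
    (Y : set H) (Y_neq0 : Y !=set0) (Y_open : open Y)
    (f : H -> H) (f_cont : {within Y, continuous f}) :
  (exists phi : H -> \bar R,
      never_ninfty phi /\ proximity_operator phi Y f)
  <->
  (exists psi : H -> \bar R,
      [/\ never_ninfty psi, econvex psi, C1_on psi Y &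
          forall y, Y y -> is_gradient ip (fine \o psi) y (f y)]).
Proof.
have {}f_cont : {in Y, continuous f} by rewrite -continuous_open_subspace.
split=> [[phi [_ /(proximity_subgradient ip_norm) [p sub_p]]]|].
  have [psi [psi_ninfty psi_cvx psiE]] := subgradient_extension Y_neq0 sub_p.
  have psi_sub : subgradient_on ip Y f (fine \o psi).
    by move=> y z Yy Yz; rewrite /= !psiE//; exact: sub_p.
  have psi_grad := subgradient_gradient ip_norm Y_open f_cont psi_sub.
  exists psi; split=> //; apply: (subgradient_C1 ip_norm f_cont) => // y Yy.
  by rewrite psiE.
move=> [psi [psi_ninfty psi_cvx [psi_fin _ _] psi_grad]].
apply: (subgradient_proximity ip_norm Y_neq0).
exact: (convex_subgradient psi_ninfty psi_cvx psi_fin psi_grad).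
Qed.
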